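(* Let $(Q,\star)$ be a cyclic group of odd order $n$ with identity element $1$. Let $L_1$ be the left translation of $(Q,\star)$ by $1$ and let $\lambda_1$ be the left middle translation of $(Q,\star)$ at $1$. Define a binary operation $+$ on $Q$ by $$x+y=L_1(x)\star\lambda_1(y)\star x\qquad\text{for all }x,y\in Q.$$ Then $(Q,+)$ is a LIPQ of odd order $n$.
   Context: For a quasigroup $(Q,\star)$ and $i\in Q$: the left translation is $L_i(x)=i\star x$; the left middle translation $\lambda_i:Q\to Q$ is the permutation determined by $\lambda_i(x)\star x=i$ for all $x\in Q$. A groupoid $(Q,\circ)$ is a latin quandle if it is idempotent ($x\circ x=x$), for all $a,b\in Q$ each of the equations $a\circ x=b$ and $y\circ a=b$ has a unique solution in $Q$, and it is left and right distributive: $a\circ(x\circ y)=(a\circ x)\circ(a\circ y)$ and $(x\circ y)\circ a=(x\circ a)\circ(y\circ a)$ for all $a,x,y\in Q$. A LIPQ is a latin quandle $(Q,\circ)$ with the left involutory property $x\circ(x\circ y)=y$ for all $x,y\in Q$. *)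

(* Defs.v *)
From HB Require Import structures.
From mathcomp Require Import all_boot all_fingroup all_solvable.

Set Implicit Arguments.
Unset Strict Implicit.
Unset Printing Implicit Defensive.

Definition quasigroup (Q : Type) (op : Q -> Q -> Q) : Prop :=
  (forall a b : Q, exists! x : Q, op a x = b) /\
  (forall a b : Q, exists! y : Q, op y a = b).

Definition left_translation (Q : Type) (op : Q -> Q -> Q) (i x : Q) : Q :=
  op i x.

(* lambda is the left middle translation of (Q, op) at i; existence and
   uniqueness in a finite quasigroup is left_middle_translation_unique. *)
Definition is_left_middle_translation (Q : finType) (op : Q -> Q -> Q) (i : Q)
    (lambda : {perm Q}) : Prop :=
  forall x : Q, op (lambda x) x = i.

Definition latin_quandle (Q : Type) (op : Q -> Q -> Q) : Prop :=
  [/\ forall x, op x x = x,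
      quasigroup op,
      forall a x y, op a (op x y) = op (op a x) (op a y)
    & forall a x y, op (op x y) a = op (op x a) (op y a)].

Definition LIPQ (Q : Type) (op : Q -> Q -> Q) : Prop :=
  latin_quandle op /\ (forall x y, op x (op x y) = y).

Lemma left_middle_translation_unique (Q : finType) (op : Q -> Q -> Q) (i : Q) :
  quasigroup op ->
  exists! lambda : {perm Q}, is_left_middle_translation op i lambda.
Proof.
case=> [opl opr].
have ex x : exists z, op z x == i by have [z [/eqP ? _]] := opr x i; exists z.
pose f x := xchoose (ex x).
have fE x : op (f x) x = i by apply/eqP/(xchooseP (ex x)).
have f_inj : injective f.
  move=> x y fxy; have [z [_ zu]] := opl (f x) i.
  by rewrite -(zu x (fE x)); apply: zu; rewrite fxy.
exists (perm f_inj); split=> [x|l lE]; first by rewrite permE.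
apply/permP=> x; rewrite permE; have [z [_ zu]] := opr x i.
by rewrite -(zu _ (fE x)); apply: zu.
Qed.

Lemma group_quasigroup (gT : finGroupType) : quasigroup (@mulg gT).
Proof.
split=> a b.
  by exists (a^-1 * b)%g; split=> [|x <-]; rewrite ?mulKVg ?mulKg.
by exists (b * a^-1)%g; split=> [|y <-]; rewrite ?mulgKV ?mulgK.
Qed.

(* Main.v *)
(** Since [L_1] is the identity and [lambda_1] is inversion, [x + y] is
    [x y^-1 x].  In every group this operation is idempotent, left
    distributive and left involutory, and [a + x = b] has a unique solution.
    In an abelian group it equals [x^2 y^-1], which gives right distributivity
    and reduces [y + a = b] to [y^2 = b a]; squaring is bijective because the
    order is odd. *)
Require Import Defs.
From HB Require Import structures.
From mathcomp Require Import all_boot all_fingroup all_solvable.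

Set Implicit Arguments.
Unset Strict Implicit.
Unset Printing Implicit Defensive.

Section CoreOperation.

Local Open Scope group_scope.
Variable gT : finGroupType.
Implicit Types a b x y : gT.

(** This is Bruck's core of a group; in additive abelian notation it is the Takasaki quandle
    [2x - y]. *)
Definition core_op x y := x * y^-1 * x.

Lemma core_op_idem x : core_op x x = x.
Proof. by rewrite /core_op mulgV mul1g. Qed.

Lemma core_op_involutive x : involutive (core_op x).
Proof. by move=> y; rewrite /core_op !invMg invgK !mulgA mulgV mul1g mulgKV. Qed.

(** Both sides cancel to [a x^-1 y x^-1 a]. *)
Lemma core_op_left_distr a x y :
  core_op a (core_op x y) = core_op (core_op a x) (core_op a y).
Proof. by rewrite /core_op !invMg !invgK !mulgA !mulgK mulgKV. Qed.

(** For odd |G|, twice [uphalf] |G| is |G| + 1, and x^|G| = 1, so this power undoes squaring. *)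
Lemma odd_order_sqrtgK x :
  odd #|[set: gT]| -> (x ^+ 2) ^+ uphalf #|[set: gT]| = x.
Proof.
move=> oddG; rewrite -expgM mul2n odd_uphalfK // expgS.
by rewrite expg_cardG ?inE // mulg1.
Qed.

Hypothesis mulgC : @commutative gT gT *%g.

Lemma core_op_abelianE x y : core_op x y = x ^+ 2 * y^-1.
Proof. by rewrite /core_op -mulgA (mulgC y^-1) mulgA. Qed.

Lemma core_op_right_distr a x y :
  core_op (core_op x y) a = core_op (core_op x a) (core_op y a).
Proof.
have sqM (u v : gT) : (u * v) ^+ 2 = u ^+ 2 * v ^+ 2 by exact: expgMn (mulgC u v).
(* Both sides equal [x^4 y^-2 a^-1]. *)
rewrite !core_op_abelianE !sqM !invMg invgK -!mulgA; congr (_ * _).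
by rewrite mulKg [a^-1 * _]mulgC -!mulgA.
Qed.

Lemma core_op_quasigroup : odd #|[set: gT]| -> quasigroup core_op.
Proof.
move=> oddG; split=> a b.
  (* An involution is its own inverse, which gives existence and uniqueness at once. *)
  exists (core_op a b); split=> [|x <-]; exact: core_op_involutive.
exists ((b * a) ^+ uphalf #|[set: gT]|); split=> [|y <-].
  (* Swapping the two exponents makes the left inverse of squaring a right inverse too. *)
  by rewrite core_op_abelianE expgAC odd_order_sqrtgK // mulgK.
by rewrite core_op_abelianE mulgKV odd_order_sqrtgK.
Qed.

Lemma core_op_LIPQ : odd #|[set: gT]| -> LIPQ core_op.
Proof.
move=> oddG; split; last exact: core_op_involutive.
split; [exact: core_op_idem | exact: core_op_quasigroup |
        exact: core_op_left_distr | exact: core_op_right_distr].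
Qed.

End CoreOperation.

(** The hypothesis on [plus] is only a pointwise equation, so the property is transported along
    [=2]. *)
Lemma LIPQ_ext (Q : Type) (op op' : Q -> Q -> Q) :
  op =2 op' -> LIPQ op -> LIPQ op'.
Proof.
move=> E [[idem [divl divr] dl dr] inv]; split=> [|x y]; last by rewrite -!E.
split=> [x||a x y|a x y]; rewrite -?E //; try by rewrite -!E.
split=> a b.
  have [x [xE xU]] := divl a b; exists x.
  by split=> [|z]; rewrite -E //; apply: xU.
have [y [yE yU]] := divr a b; exists y.
by split=> [|z]; rewrite -E //; apply: yU.
Qed.

Theorem theorem2p3 (Q : finGroupType) (n : nat)
    (hcyc : cyclic [set: Q]) (hcard : #|Q| = n) (hodd : odd n)
    (lambda1 : {perm Q})
    (hlambda1 : is_left_middle_translation (@mulg Q) 1%g lambda1)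
    (plus : Q -> Q -> Q)
    (hplus : forall x y : Q,
       plus x y = (left_translation (@mulg Q) 1%g x * lambda1 y * x)%g) :
  LIPQ plus /\ #|Q| = n /\ odd n.
Proof.
split; last by split.
have lambda1E y : lambda1 y = (y^-1)%g.
  by apply: (mulIg y); rewrite hlambda1 mulVg.
have mulQC : @commutative Q Q *%g.
  by move=> x y; apply: (centsP (cyclic_abelian hcyc)); rewrite inE.
apply: (@LIPQ_ext _ (@core_op Q)) => [x y|].
  by rewrite hplus lambda1E /left_translation mul1g.
by apply: core_op_LIPQ; rewrite // cardsT hcard.
Qed.
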